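(* The class of all finite groups in which every Sylow subgroup is submodular is a local formation and has a local screen $f$ such that, for every prime $p$, $f(p)$ is the class of all soluble groups all of whose Sylow subgroups belong to $\mathfrak{A}(p-1)\cap\mathfrak{B}$. (That is, this class equals $LF(f)$ for this $f$.)
   Context: All groups are finite. A subgroup $M$ of a group $G$ is called modular in $G$ if: (1) $\langle X, M\cap Z\rangle=\langle X,M\rangle\cap Z$ for all $X\le G$, $Z\le G$ with $X\le Z$; and (2) $\langle M, Y\cap Z\rangle=\langle M,Y\rangle\cap Z$ for all $Y\le G$, $Z\le G$ with $M\le Z$. A subgroup $H$ of $G$ is called submodular in $G$ if there is a chain of subgroups $H=H_0\le H_1\le\dots\le H_s=G$ such that $H_{i-1}$ is modular in $H_i$ for $i=1,\dots,s$. $\mathfrak{A}(p-1)$ is the class of all abelian groups of exponent dividing $p-1$; $\mathfrak{B}$ is the class of all abelian groups whose exponent is squarefree (not divisible by the square of any prime). A class of groups (closed under isomorphism) $\mathfrak{F}$ is a formation if (a) every quotient of a group in $\mathfrak{F}$ lies in $\mathfrak{F}$, and (b) whenever $A,B$ are normal subgroups of a group $H$ with $H/A\in\mathfrak{F}$ and $H/B\in\mathfrak{F}$, then $H/(A\cap B)\in\mathfrak{F}$. A local screen is a function $f$ from the set of all primes to formations. $LF(f)$ denotes the class of all groups $G$ such that $G/C_G(H/K)\in f(p)$ for every chief factor $H/K$ of $G$ and every prime $p$ dividing $|H/K|$. A formation $\mathfrak{F}$ is local if $\mathfrak{F}=LF(f)$ for some local screen $f$; then $f$ is a local screen of $\mathfrak{F}$.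 *)

(* Defs.v *)
From mathcomp Require Import all_boot all_fingroup all_solvable.

Set Implicit Arguments.
Unset Strict Implicit.
Unset Printing Implicit Defensive.

Import GroupScope.

Definition modular_in (gT : finGroupType) (M G : {group gT}) : bool :=
  [&& M \subset G,
      [forall X : {group gT}, forall Z : {group gT},
         [&& X \subset G, Z \subset G & X \subset Z] ==>
         (X <*> (M :&: Z) == (X <*> M) :&: Z)]
    & [forall Y : {group gT}, forall Z : {group gT},
         [&& Y \subset G, Z \subset G & M \subset Z] ==>
         (M <*> (Y :&: Z) == (M <*> Y) :&: Z)]].

Definition submodular (gT : finGroupType) (H G : {group gT}) : Prop :=
  exists s : seq {group gT}, path (@modular_in gT) H s /\ last H s = G.

(* Group classes are predicates on all finite groups, presented as subgroups
   of an arbitrary finite ambient group; they need not be closed under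
   isomorphism unless [iso_closed] holds. *)
Definition group_class := forall gT : finGroupType, {group gT} -> Prop.

Definition same_class (F1 F2 : group_class) : Prop :=
  forall (gT : finGroupType) (G : {group gT}), F1 gT G <-> F2 gT G.

Definition iso_closed (F : group_class) : Prop :=
  forall (gT rT : finGroupType) (G : {group gT}) (H : {group rT}),
    G \isog H -> F gT G -> F rT H.

Definition formation (F : group_class) : Prop :=
  [/\ iso_closed F,
      forall (gT : finGroupType) (G N : {group gT}),
        N <| G -> F gT G -> F _ (G / N)%G
    & forall (gT : finGroupType) (H A B : {group gT}),
        A <| H -> B <| H -> F _ (H / A)%G -> F _ (H / B)%G ->
        F _ (H / (A :&: B))%G].

(* Only the values of a screen at primes are meaningful. *)
Definition local_screen (f : nat -> group_class) : Prop :=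
  forall p : nat, prime p -> formation (f p).

Definition LF (f : nat -> group_class) : group_class :=
  fun gT G => forall (H K : {group gT}) (p : nat),
    chief_factor G K H -> prime p -> p %| #|H / K| ->
    f p _ (G / 'C_G(H / K | 'Q))%G.

Definition local_screen_of (f : nat -> group_class) (F : group_class) : Prop :=
  local_screen f /\ same_class F (LF f).

Definition local_formation (F : group_class) : Prop :=
  formation F /\ exists f : nat -> group_class, local_screen_of f F.

Definition abelian_exponent_dvd (n : nat) : group_class :=
  fun gT G => abelian G /\ exponent G %| n.

Definition abelian_squarefree_exponent : group_class :=
  fun gT G =>
    abelian G /\ forall q : nat, prime q -> ~~ ((q ^ 2)%N %| exponent G).

Definition sylow_submodular : group_class :=
  fun gT G => forall (q : nat) (P : {group gT}),
    prime q -> q.-Sylow(G) P -> submodular P G.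

Definition soluble_sylow_in (F : group_class) : group_class :=
  fun gT G => solvable G /\
    forall (q : nat) (P : {group gT}), prime q -> q.-Sylow(G) P -> F gT P.

Definition sylow_screen (p : nat) : group_class :=
  soluble_sylow_in (fun gT P =>
    abelian_exponent_dvd p.-1 P /\ abelian_squarefree_exponent P).

(* Main.v *)
Require Import Defs.
From mathcomp Require Import all_boot all_fingroup all_solvable.
From mathcomp Require Import all_algebra all_field all_character.

(* If M is maximal among the proper modular subgroups of G and M is not normal,
   then M is a maximal subgroup, every subgroup Y of G not contained in M meets
   M in a maximal subgroup of Y, and the Frattini subgroup of every subgroup of
   G lies in the core of M.  From this, when a q-group Q is submodular in VQ,
   with V an abelian normal p-group and q <> p, the quotient Q / C_Q(V) is
   elementary abelian, and it is trivial unless q divides p - 1.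

   Let every Sylow subgroup of G be submodular.  A simple such G has abelian
   Sylow subgroups (they have trivial Frattini subgroup), hence is abelian by
   Burnside's transfer argument at the smallest prime; so G is soluble.  Let V
   be a p-chief factor and A = G / C_G(V).  The action result above bounds the
   Sylow q-subgroups of A for q <> p.  As all primes q <> p dividing |A| are
   smaller than p, the action result also shows that a Sylow p-subgroup of A
   centralises F(A), so it lies in O_p(F(A)) = O_p(A) = 1.

   Conversely, if Q / C_Q(V) is abelian of exponent dividing gcd(q, p - 1), then
   every Q-irreducible section of V has order p, because every element of Q has
   an eigenvector over F_p; so one descends from VQ to Q through modular
   subgroups of index p, and a chief series of G gives the claim. *)

Set Implicit Arguments.
Unset Strict Implicit.
Unset Printing Implicit Defensive.

Import GRing.Theory.
Import GroupScope.

(** * Modular and submodular subgroups *)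

Section ModularSubgroups.

Variable gT : finGroupType.
Implicit Types M G H K L N U X Y Z W : {group gT}.

Lemma modular_inP M G :
  reflect [/\ M \subset G,
      forall X Z, X \subset Z -> Z \subset G ->
        X <*> (M :&: Z) = (X <*> M) :&: Z
    & forall Y Z, Y \subset G -> M \subset Z -> Z \subset G ->
        M <*> (Y :&: Z) = (M <*> Y) :&: Z]
    (modular_in M G).
Proof.
apply: (iffP and3P) => [[sMG m1 m2] | [sMG m1 m2]]; split=> //.
- move=> X Z sXZ sZG; apply/eqP.
  have /forallP/(_ Z)/implyP := forallP m1 X; apply.
  by rewrite sZG sXZ (subset_trans sXZ).
- move=> Y Z sYG sMZ sZG; apply/eqP.
  have /forallP/(_ Z)/implyP := forallP m2 Y; apply.
  by rewrite sYG sMZ sZG.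
- apply/forallP=> X; apply/forallP=> Z; apply/implyP=> /and3P[_ sZG sXZ].
  exact/eqP/m1.
apply/forallP=> Y; apply/forallP=> Z; apply/implyP=> /and3P[sYG sZG sMZ].
exact/eqP/m2.
Qed.

Lemma modular_sub M G : modular_in M G -> M \subset G.
Proof. by case/and3P. Qed.

Lemma modular_normal M G : M <| G -> modular_in M G.
Proof.
case/andP=> sMG nMG; apply/modular_inP; split=> // [X Z sXZ sZG | Y Z sYG sMZ _].
  have nMX : X \subset 'N(M) := subset_trans sXZ (subset_trans sZG nMG).
  have nMX' : X \subset 'N(M :&: Z) by rewrite normsI // normsG.
  by rewrite !norm_joinEl ?group_modl.
have nMY : Y \subset 'N(M) := subset_trans sYG nMG.
by rewrite !norm_joinEr ?group_modl // subIset ?nMY.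
Qed.

(** For condition (1), [A] contains [M :&: Z], so modularity of [M] gives [A = (A <*> M) :&: Z];
    [e1], [e2] and [e3] identify [A <*> M] with [(X <*> (M <*> N)) :&: (Z <*> M)]. *)
Lemma modular_join M N G :
  modular_in M G -> modular_in N G -> modular_in (M <*> N)%G G.
Proof.
case/modular_inP=> sMG m1 m2 /modular_inP[sNG n1 n2].
apply/modular_inP; split=> [|X Z sXZ sZG|Y Z sYG sMNZ sZG] /=.
- by rewrite join_subG sMG.
- have sXG := subset_trans sXZ sZG.
  have sZMG : Z <*> M \subset G by rewrite join_subG sZG.
  pose A := (X <*> ((M <*> N) :&: Z))%G.
  have sAZ : A \subset Z by rewrite join_subG sXZ subsetIr.
  have e1 : X <*> M <*> (N :&: (Z <*> M)) = (X <*> M <*> N) :&: (Z <*> M).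
    by apply: (n1 (X <*> M)%G (Z <*> M)%G) => //; rewrite genS ?setSU.
  have e2 : M <*> (N :&: (Z <*> M)) = (M <*> N) :&: (Z <*> M).
    by apply: (n1 M (Z <*> M)%G) => //; rewrite joing_subr.
  have e3 : M <*> (Z :&: (M <*> N)) = (M <*> Z) :&: (M <*> N).
    by apply: (m2 Z (M <*> N)%G) => //; rewrite ?joing_subl // join_subG sMG.
  have e4 : A <*> (M :&: Z) = (A <*> M) :&: Z by exact: m1.
  have e5 : A <*> M = (X <*> (M <*> N)) :&: (Z <*> M).
    rewrite /= -joingA [_ <*> M]joingC [_ :&: Z]setIC e3 joingA -e1 -joingA e2.
    by rewrite setIC [Z <*> M]joingC.
  have -> : (X <*> (M <*> N)) :&: Z = (A <*> M) :&: Z.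
    by rewrite e5 -setIA [(Z <*> M) :&: Z](setIidPr _) ?joing_subl.
  have sMA : M :&: Z \subset A.
    exact: subset_trans (setSI _ (joing_subl _ _)) (joing_subr _ _).
  by rewrite -e4 (joing_idPl sMA).
have [sMZ sNZ] : M \subset Z /\ N \subset Z by apply/andP; rewrite -join_subG.
rewrite -!joingA n2 // (m2 (N <*> Y)%G) //=.
by rewrite join_subG sNG.
Qed.

Lemma modularJ M G x : x \in G -> modular_in M G -> modular_in (M :^ x)%G G.
Proof.
move=> Gx /modular_inP[sMG m1 m2]; apply/modular_inP.
have conjK X : (X :^ x^-1) :^ x = X by rewrite conjsgKV.
have sJ X : (X :^ x^-1 \subset G) = (X \subset G).
  by rewrite sub_conjgV conjGid.
split=> [|X Z sXZ sZG|Y Z sYG sMZ sZG] /=.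
- by rewrite -(conjGid Gx) conjSg.
- rewrite -(conjK X) -(conjK Z) -(conjIg _ _ x) -!conjYg -(conjIg _ _ x); congr (_ :^ _).
  by apply: (m1 (X :^ x^-1)%G (Z :^ x^-1)%G); rewrite ?conjSg ?sJ.
rewrite -(conjK Y) -(conjK Z) -(conjIg _ _ x) -!conjYg -(conjIg _ _ x); congr (_ :^ _).
by apply: (m2 (Y :^ x^-1)%G (Z :^ x^-1)%G); rewrite ?sJ // -sub_conjg.
Qed.

Lemma modular_setI M G U :
  modular_in M G -> U \subset G -> modular_in (M :&: U)%G U.
Proof.
case/modular_inP=> sMG m1 m2 sUG.
have mU X : X \subset U -> X <*> (M :&: U) = (X <*> M) :&: U.
  by move=> sXU; apply: m1.
apply/modular_inP; split=> [|X Z sXZ sZU|Y Z sYU sMZ sZU] /=.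
- exact: subsetIr.
- rewrite mU ?(subset_trans sXZ) // -!setIA (setIidPr sZU) m1 //.
  exact: subset_trans sUG.
have sZG := subset_trans sZU sUG; have sYG := subset_trans sYU sUG.
(* [M <*> Z] contains [M] and meets [U] in [Z], so it stands in for [Z] in condition (2) for [M]. *)
have defZ : (M <*> Z) :&: U = Z.
  by rewrite [M <*> Z]joingC -mU //; apply/joing_idPl.
have defYZ : Y :&: Z = Y :&: (M <*> Z).
  by rewrite -{1}defZ setIA -setIAC (setIidPl sYU).
have e : M <*> (Y :&: Z) = (M <*> Y) :&: (M <*> Z).
  rewrite defYZ; apply: (m2 Y (M <*> Z)%G) => //; first exact: joing_subl.
  by rewrite join_subG sMG.
rewrite -[_ <*> Y]joingC mU // [Y <*> M]joingC joingC.
rewrite (mU (Y :&: Z)%G) /=; last by rewrite subIset ?sYU.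
by rewrite joingC e -!setIA defZ (setIidPr sZU).
Qed.

(** Excludes a strict chain [1 < X < Z < G] when [#|G|] is a product of two primes. *)
Lemma three_factors_prime2 (p q a b c : nat) :
  prime p -> prime q -> 1 < a -> 1 < b -> 1 < c -> (a * b * c)%N != (p * q)%N.
Proof.
move=> p_pr q_pr; have p_gt0 := prime_gt0 p_pr; have q_gt0 := prime_gt0 q_pr.
have aux a' b' c' : p %| a' -> 1 < b' -> 1 < c' -> (a' * b' * c')%N <> (p * q)%N.
  case/dvdnP=> k -> b_gt1 c_gt1 /eqP.
  rewrite [(k * p)%N]mulnC -!mulnA eqn_pmul2l // => /eqP def_q.
  have def_b : b' = q.
    apply/prime_nt_dvdP; rewrite // ?neq_ltn ?b_gt1 ?orbT //.
    by rewrite -def_q dvdn_mull ?dvdn_mulr.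
  move/eqP: def_q; rewrite def_b mulnCA -{2}[q]muln1 eqn_pmul2l // muln_eq1.
  by rewrite andbC eqn_leq leqNgt c_gt1.
move=> a1 b1 c1; apply/eqP=> def_pq.
have : p %| a * b * c by rewrite def_pq dvdn_mulr.
rewrite !Euclid_dvdM // => /orP[/orP[]|] p_dv.
- exact: (aux a b c).
- by apply: (aux b a c) => //; rewrite [(b * a)%N]mulnC.
by apply: (aux c a b) => //; rewrite -mulnA mulnC.
Qed.

(** As [#|G|] is a product of two primes, condition (1) has no case with [1 < X < Z < G], and
    condition (2) leaves only [Z = M] and [Z = G]. *)
Lemma modular_prime M G :
  M \subset G -> prime #|M| -> prime #|G : M| -> modular_in M G.
Proof.
move=> sMG prM prGM; apply/modular_inP; split=> // [X Z sXZ sZG | Y Z sYG sMZ sZG].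
  have [-> | ntX] := eqVneq X 1%G; first by rewrite !joing1G.
  have [-> | neqXZ] := eqVneq X Z.
    by rewrite (setIidPr (joing_subl _ _)); apply/joing_idPl; rewrite subsetIr.
  have [-> | neqZG] := eqVneq Z G.
    rewrite (setIidPl sMG); apply/esym/setIidPl.
    by rewrite join_subG sMG (subset_trans sXZ).
  have ltX : 1 < #|X| by rewrite cardG_gt1.
  have ltXZ : 1 < #|Z : X|.
    by rewrite indexg_gt1; apply: contra neqXZ => sZX; rewrite -val_eqE eqEsubset sXZ.
  have ltZG : 1 < #|G : Z|.
    by rewrite indexg_gt1; apply: contra neqZG => sGZ; rewrite -val_eqE eqEsubset sZG.
  have := three_factors_prime2 prM prGM ltX ltXZ ltZG.
  by rewrite !Lagrange ?eqxx.
have [-> | neqZG] := eqVneq Z G.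
  by rewrite (setIidPl sYG); apply/esym/setIidPl; rewrite join_subG sMG.
suffices -> : Z = M.
  by rewrite [RHS](setIidPr (joing_subl _ _)); apply/joing_idPl; rewrite subsetIr.
apply/eqP; apply: contraR neqZG => neqZM.
have := prGM; rewrite -(Lagrange_index sZG sMZ) => prM2.
rewrite -val_eqE eqEsubset sZG -indexg_eq1 /=.
have ltMZ : 1 < #|Z : M|.
  by rewrite indexg_gt1; apply: contra neqZM => sZM; rewrite -val_eqE eqEsubset sMZ andbT.
have /primeP[_ /(_ _ (dvdn_mulr _ (dvdnn _)))] := prM2.
case/pred2P=> [-> //|]; move/eqP; rewrite -{1}[#|G : Z|]muln1 eqn_pmul2l //.
by rewrite eq_sym eqn_leq leqNgt ltMZ.
Qed.

End ModularSubgroups.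

(** The identities hold modulo [N]. In condition (1), intersecting with [Z] reduces the error factor
    [N] to [Z :&: N], which lies in [M :&: Z]; in condition (2), [N] is absorbed by [M]. *)
Lemma modular_preim (gT : finGroupType) (N M G : {group gT}) :
  N <| G -> N \subset M -> M \subset G ->
  modular_in (M / N)%G (G / N)%G -> modular_in M G.
Proof.
move=> nsNG sNM sMG /modular_inP[_ m1 m2]; have [sNG nNG] := andP nsNG.
have nN (X : {group gT}) : X \subset G -> X \subset 'N(N) by move/subset_trans; apply.
apply/modular_inP; split=> // [X Z sXZ sZG | Y Z sYG sMZ sZG].
  have sXG := subset_trans sXZ sZG.
  set W := X <*> (M :&: Z).
  have sWZ : W \subset Z by rewrite join_subG sXZ subsetIr.
  apply/eqP; rewrite eqEsubset subsetI sWZ andbT.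
  rewrite (genS (setUS _ (subsetIl _ _))) /=.
  have : ((X <*> M) :&: Z) / N \subset W / N.
    rewrite /W !quotientY ?nN ?(subset_trans (subsetIl _ _)) //.
    rewrite quotientGI // (m1 (X / N)%G (Z / N)%G) ?quotientS //.
    by rewrite -quotientY ?nN ?quotientI.
  rewrite quotientSK; last by rewrite subIset // nN // join_subG sXG.
  move=> sub; have {}sub : X <*> M :&: Z \subset Z :&: N * W.
    by rewrite subsetI subsetIr.
  rewrite -group_modr // in sub; apply: subset_trans sub _.
  rewrite mul_subG // (subset_trans _ (joing_subr _ _)) // setIC setSI //.
have sNZ := subset_trans sNM sMZ.
set W := M <*> (Y :&: Z).
have sWZ : W \subset Z by rewrite join_subG sMZ subsetIr.
apply/eqP; rewrite eqEsubset subsetI sWZ andbT.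
rewrite (genS (setUS _ (subsetIl _ _))) /=.
have : ((M <*> Y) :&: Z) / N \subset W / N.
  rewrite /W !quotientY ?nN ?(subset_trans (subsetIl _ _)) //.
  rewrite !quotientIG // (m2 (Y / N)%G (Z / N)%G) ?quotientS //.
  by rewrite quotientY ?nN.
rewrite quotientSK ?mulSGid //; first by rewrite (subset_trans sNM) ?joing_subl.
by rewrite subIset // nN // join_subG sMG.
Qed.

(** The preimage of [Z] contains the kernel, so [f] respects intersections with it, and the
    identities for preimages map to the required ones. *)
Lemma modular_morphim (aT rT : finGroupType) (G M : {group aT})
    (f : {morphism G >-> rT}) :
  modular_in M G -> modular_in (f @* M)%G (f @* G)%G.
Proof.
case/modular_inP=> sMG m1 m2; apply/modular_inP.
have preK (X : {group rT}) : X \subset f @* G -> f @* (f @*^-1 X) = X by exact: morphpreK.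
have sPG (X : {group rT}) : f @*^-1 X \subset G by exact: subsetIl.
have sKP (X : {group rT}) : 'ker f \subset f @*^-1 X by rewrite morphpreS ?sub1G.
split=> [|X Z sXZ sZG|Y Z sYG sMZ sZG]; first exact: morphimS.
  have sXG := subset_trans sXZ sZG.
  have /= e := m1 (f @*^-1 X)%G (f @*^-1 Z)%G (morphpreS f sXZ) (sPG Z).
  have sIG : M :&: f @*^-1 Z \subset G by rewrite subIset ?sPG ?orbT.
  have /= := congr1 (fun A : {set aT} => f @* A) e.
  rewrite (morphimIG _ (sKP Z)) (morphimY f (sPG X) sIG) (morphimIG _ (sKP Z)).
  by rewrite (morphimY f (sPG X) sMG) !preK.
have sMZ' : M \subset f @*^-1 Z by rewrite -sub_morphim_pre.
have /= e := m2 (f @*^-1 Y)%G (f @*^-1 Z)%G (sPG Y) sMZ' (sPG Z).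
have sIG : f @*^-1 Y :&: f @*^-1 Z \subset G by rewrite subIset ?sPG ?orbT.
have /= := congr1 (fun A : {set aT} => f @* A) e.
rewrite (morphimIG _ (sKP Z)) (morphimY f sMG sIG) (morphimIG _ (sKP Z)).
by rewrite (morphimY f sMG (sPG Y)) !preK.
Qed.

Lemma modular_morphim_sub (aT rT : finGroupType) (D M H : {group aT})
    (f : {morphism D >-> rT}) :
  H \subset D -> modular_in M H -> modular_in (f @* M)%G (f @* H)%G.
Proof.
move=> sHD modMH; have := modular_morphim (restrm_morphism sHD f) modMH.
congr modular_in; apply: val_inj; rewrite /= morphim_restrm ?setIid //.
by rewrite (setIidPr (modular_sub modMH)).
Qed.

Lemma modular_cosetpre (gT : finGroupType) (N : {group gT})
    (M H : {group coset_of N}) :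
  modular_in M H -> modular_in (coset N @*^-1 M)%G (coset N @*^-1 H)%G.
Proof.
move=> modMH; apply: (@modular_preim _ N); rewrite ?sub_cosetpre ?cosetpreSK //=.
- rewrite /normal sub_cosetpre subsetIl //.
- exact: modular_sub modMH.
by move: modMH; congr modular_in; apply: val_inj; rewrite /= cosetpreK.
Qed.

(** * Submodular subgroups: chains, intersections, images and preimages *)

Section Submodular.

Variable gT : finGroupType.
Implicit Types M G H K L N U X Y Z W : {group gT}.

Lemma submodular_refl G : submodular G G.
Proof. by exists [::]. Qed.

Lemma submodular_trans H K G : submodular H K -> submodular K G -> submodular H G.
Proof.
case=> s1 [p1 <-] [s2 [p2 <-]]; exists (s1 ++ s2).
by rewrite cat_path last_cat p1.
Qed.

Lemma modular_submodular M G : modular_in M G -> submodular M G.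
Proof. by move=> modMG; exists [:: G]; rewrite /= andbT. Qed.

Lemma submodular_last_ind G (P : {group gT} -> Prop) :
    P G ->
    (forall M H, submodular M H -> submodular H G -> modular_in M H -> P H -> P M) ->
  forall H, submodular H G -> P H.
Proof.
move=> PG IH H [s [pth lst]]; elim: s H pth lst => [|K s IHs] H /=.
  by move=> _ ->.
case/andP=> modHK pth lst; apply: (IH H K) => //; last exact: IHs.
  exact: modular_submodular.
by exists s.
Qed.

Lemma submodular_sub H G : submodular H G -> H \subset G.
Proof.
move: H; apply: submodular_last_ind => // M K _ _ /modular_sub sMK.
exact: subset_trans.
Qed.

End Submodular.

Section SubmodularMaps.

Variable gT : finGroupType.
Implicit Types M G H K U : {group gT}.

(** Treats intersection with a fixed subgroup, homomorphic images and coset preimages uniformly. *)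
Lemma submodular_map (rT : finGroupType) (phi : {group gT} -> {group rT}) G H :
    (forall M K, K \subset G -> modular_in M K -> modular_in (phi M) (phi K)) ->
  submodular H G -> submodular (phi H) (phi G).
Proof.
move=> modphi; move: H.
apply: submodular_last_ind => [|M K _ subKG modMK].
  exact: submodular_refl.
apply: submodular_trans; apply/modular_submodular/modphi => //.
exact: submodular_sub.
Qed.

Lemma submodular_setI H G U : submodular H G -> submodular (H :&: U)%G (G :&: U)%G.
Proof.
apply: (submodular_map (phi := fun K => (K :&: U)%G)) => M K _ modMK.
have := modular_setI modMK (subsetIl K U); congr modular_in; apply: val_inj.
by rewrite /= setIA (setIidPl (modular_sub modMK)).
Qed.

Lemma submodular_subgroup H G U :
  submodular H G -> H \subset U -> U \subset G -> submodular H U.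
Proof.
move=> subHG sHU sUG; have := submodular_setI U subHG.
by congr submodular; apply: val_inj => /=; [apply/setIidPl | apply/setIidPr].
Qed.

Lemma submodular_intersect H K G :
  submodular H G -> submodular K G -> submodular (H :&: K)%G G.
Proof.
move=> subHG subKG; apply: (submodular_trans _ subKG).
have := submodular_setI K subHG; congr submodular; apply: val_inj.
exact/setIidPr/(submodular_sub subKG).
Qed.

Lemma submodular_morphim (rT : finGroupType) (D : {group gT})
    (f : {morphism D >-> rT}) H G :
  G \subset D -> submodular H G -> submodular (f @* H)%G (f @* G)%G.
Proof.
move=> sGD; apply: (submodular_map (phi := fun K => (f @* K)%G)) => M K sKG.
by apply: modular_morphim_sub; apply: subset_trans sGD.
Qed.

End SubmodularMaps.

Lemma submodular_cosetpre (gT : finGroupType) (N H G : {group gT}) :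
    N <| G -> N \subset H -> H \subset G ->
  submodular (H / N)%G (G / N)%G -> submodular H G.
Proof.
move=> nsNG sNH sHG.
move/(submodular_map (phi := fun K : {group coset_of N} => (coset N @*^-1 K)%G)).
move=> sub; have {sub}: submodular (coset N @*^-1 (H / N))%G (coset N @*^-1 (G / N))%G.
  by apply: sub => M K _; apply: modular_cosetpre.
congr submodular; apply: val_inj => /=; apply: quotientGK => //.
exact: normalS nsNG.
Qed.

Definition max_modular (gT : finGroupType) (M G : {group gT}) :=
  [max M of K | modular_in K G && (K \proper G)].

(** The last proper member of a chain from [H] to [G] is modular in [G]; it is then enlarged to a
    maximal one. *)
Lemma max_modular_exists (gT : finGroupType) (H G : {group gT}) :
  submodular H G -> H \proper G ->
  exists2 M : {group gT}, max_modular M G & H \subset M.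
Proof.
move=> subHG ltHG.
have [K /andP[modKG ltKG] sHK] : exists2 K : {group gT},
    modular_in K G && (K \proper G) & H \subset K.
  move: H subHG ltHG; apply: submodular_last_ind => [|M H _ subHG modMH IH ltMG].
    by rewrite properxx.
  have sMH := modular_sub modMH.
  have [eHG | neHG] := eqVneq H G.
    by exists M; rewrite // -eHG modMH eHG.
  case: IH => [|K modK sHK]; last by exists K => //; apply: subset_trans sHK.
  by rewrite properEneq neHG submodular_sub.
have [M maxM sKM] : {M : {group gT} | max_modular M G & K \subset M}.
  by apply: maxgroup_exists; rewrite modKG.
by exists M => //; apply: subset_trans sKM.
Qed.

(** * Maximal members of the set of proper modular subgroups *)

(** All maximal subgroups of a p-group have index [p], and a cyclic group has one subgroup of each
    order, so [T] is the only maximal subgroup. *)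
Lemma cyclic_pgroup_maximal_sub_Phi (p : nat) (gT : finGroupType) (Y T : {group gT}) :
  p.-group Y -> cyclic Y -> maximal T Y -> T \subset 'Phi(Y).
Proof.
move=> pY cycY maxT; apply/bigcapsP=> S /predU1P[-> | maxS].
  by rewrite proper_sub // (maxgroupp maxT).
have sTY := proper_sub (maxgroupp maxT); have sSY := proper_sub (maxgroupp maxS).
suffices /eqP-> : T :==: S by [].
rewrite (eq_subG_cyclic cycY) // -(eqn_pmul2r (indexg_gt0 Y S)) Lagrange //.
by rewrite (p_maximal_index pY maxS) -(p_maximal_index pY maxT) Lagrange.
Qed.

Section MaxModular.

Variables (gT : finGroupType) (M G : {group gT}).
Hypotheses (maxM : max_modular M G) (not_nMG : ~~ (M <| G)).
Implicit Types L W Y Z : {group gT}.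

Lemma max_modular_modular : modular_in M G.
Proof. by case/maxgroupP: maxM => /andP[]. Qed.

Lemma max_modular_proper : M \proper G.
Proof. by case/maxgroupP: maxM => /andP[]. Qed.

Let sMG : M \subset G := modular_sub max_modular_modular.

(** If [y] in [Y] does not normalise [M], the modular subgroup [M <*> M :^ y] is strictly larger
    than [M], hence equal to [G], and it lies in [M <*> Y]. *)
Lemma max_modular_not_norm Y : Y \subset G -> ~~ (Y \subset 'N(M)) -> M <*> Y = G.
Proof.
move=> sYG /subsetPn[y Yy]; apply: contraNeq => neqMYG.
have Gy := subsetP sYG y Yy.
have modJ := modular_join max_modular_modular (modularJ Gy max_modular_modular).
have sJ : M <*> M :^ y \subset M <*> Y.
  rewrite join_subG joing_subl /= -(conjGid (_ : y \in (M <*> Y)%G)).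
    by rewrite conjSg joing_subl.
  by apply: subsetP Yy; apply: joing_subr.
case/maxgroupP: maxM => _ /(_ (M <*> M :^ y)%G); rewrite modJ /= => maxMy.
have e : M <*> M :^ y = M.
  apply: maxMy; last exact: joing_subl.
  by apply: sub_proper_trans sJ _; rewrite properEneq neqMYG join_subG sMG.
by rewrite inE -{2}e joing_subr.
Qed.

(* If Z does not normalise M then <M, Z> = G; were 'Phi(Z) not to normalise M
   either, modularity would give <'Phi(Z), M :&: Z> = Z, hence Z <= M.  So the
   normal core L of 'N_G(M) contains all Frattini subgroups, and <M, L> = M by
   the maximality of M. *)
Lemma max_modular_Phi Y : Y \subset G -> 'Phi(Y) \subset gcore M G.
Proof.
have PhiN Z : Z \subset G -> 'Phi(Z) \subset 'N(M).
  move=> sZG; have [sZN | nZN] := boolP (Z \subset 'N(M)).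
    exact: subset_trans (Phi_sub Z) sZN.
  apply: contraR nZN => nPN.
  have sPZ := Phi_sub Z.
  have genM := max_modular_not_norm (subset_trans sPZ sZG) nPN.
  have [_ m1 _] := modular_inP _ _ max_modular_modular.
  have eZ : 'Phi(Z) <*> (M :&: Z) = Z.
    by rewrite (m1 'Phi(Z)%G Z) // joingC genM; apply/setIidPr.
  have := Phi_nongen eZ; rewrite genGid => <-.
  by rewrite subIset ?normG.
move=> sYG; pose L := (gcore 'N_G(M) G)%G.
have nsLG : L <| G by apply: gcore_normal; apply: subsetIl.
have sLN : L \subset 'N_G(M) by apply: gcore_sub.
have sPL : 'Phi(Y) \subset L.
  apply/bigcapsP=> x Gx; rewrite -sub_conjgV -PhiJ subsetI.
  have sYxG : Y :^ x^-1 \subset G by rewrite sub_conjgV conjGid.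
  by rewrite (PhiN (Y :^ x^-1)%G) // (subset_trans (Phi_sub _)).
have modJ := modular_join max_modular_modular (modular_normal nsLG).
have sJG : M <*> L \subset G by rewrite join_subG sMG normal_sub.
have sLM : L \subset M.
  case/maxgroupP: maxM => _ /(_ (M <*> L)%G); rewrite modJ /= => maxML.
  rewrite -[in X in _ \subset X]maxML ?joing_subl ?joing_subr //.
  rewrite properEneq sJG andbT; apply: contraNneq not_nMG => eG.
  rewrite /normal sMG -{1}eG join_subG normG.
  by rewrite (subset_trans sLN) ?subsetIr.
exact: subset_trans sPL (gcore_max sLM (normal_norm nsLG)).
Qed.

(** Sylow subgroups generate [G], so some [y] of prime power order does not normalise [M], and [M
    <*> <[y]> = G]. If [M <= W < G], modularity gives [W = M <*> (<[y]> :&: W)], where the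
    intersection is proper in [<[y]>] and so lies in its Frattini subgroup, hence in [M]. *)
Lemma max_modular_maximal : maximal M G.
Proof.
have [P sylP /subsetPn[y Py Ny]] : exists2 P : {group gT}, Sylow G P & ~~ (P \subset 'N(M)).
  apply/exists_inP; apply: contraR not_nMG; rewrite negb_exists_in => /forall_inP nP.
  rewrite /normal sMG -(Sylow_gen G) gen_subG; apply/bigcupsP=> P /nP.
  by rewrite negbK.
have [p _ /and3P[sPG pP _]] := SylowP _ _ sylP.
have sYG : <[y]> \subset G by rewrite cycle_subG (subsetP sPG).
have genM : M <*> <[y]> = G by apply: max_modular_not_norm; rewrite // cycle_subG.
have [_ _ m2] := modular_inP _ _ max_modular_modular.
apply/maxgroupP; split=> [|W ltWG sMW]; first exact: max_modular_proper.
have /= eW := m2 <[y]>%G W sYG sMW (proper_sub ltWG).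
rewrite genM (setIidPr (proper_sub ltWG)) in eW.
have sPhi := subset_trans (max_modular_Phi sYG) (gcore_sub M G).
case: (maximal_exists (subsetIl <[y]> W)) => [/= eY | [T maxT sYWT]].
  by case/andP: ltWG => _; rewrite -eW eY genM subxx.
apply/eqP; rewrite eqEsubset sMW andbT -eW join_subG subxx.
apply: subset_trans sYWT (subset_trans _ sPhi).
by apply: (@cyclic_pgroup_maximal_sub_Phi p); rewrite ?cycle_cyclic // (pgroupS _ pP) ?cycle_subG.
Qed.

(** A subgroup [W] between [Y :&: M] and [Y] equals [(W <*> M) :&: Y] by modularity, and [W <*> M]
    can only be [M] or [G]. *)
Lemma max_modular_setI Y :
  Y \subset G -> ~~ (Y \subset M) -> maximal (Y :&: M) Y.
Proof.
move=> sYG nsYM; have [_ m1 _] := modular_inP _ _ max_modular_modular.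
apply/maxgroupP; split=> [|W /andP[sWY nsYW] sYMW].
  by rewrite properE subsetIl subsetI subxx.
have eW : W :=: (W <*> M) :&: Y.
  by rewrite -m1 // setIC; apply/esym/joing_idPl.
case/maxgroupP: max_modular_maximal => _ /(_ (W <*> M)%G) maxWM.
have [eG | neG] := eqVneq (W <*> M) G.
  by case/negP: nsYW; rewrite eW eG subsetI sYG subxx.
rewrite eW /= maxWM ?joing_subr 1?setIC //.
by rewrite properEneq neG join_subG sMG (subset_trans sWY).
Qed.

End MaxModular.

(** * Coprime action of a submodular subgroup *)

(** The image of [Q] in [Aut V] is a q-group of order dividing [p - 1]. *)
Lemma pgroup_norm_prime_cent (gT : finGroupType) (p q : nat) (V Q : {group gT}) :
  prime p -> prime q -> #|V| = p -> q.-group Q -> Q \subset 'N(V) ->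
  Q \subset 'C(V) \/ q %| p.-1.
Proof.
move=> p_pr q_pr oV qQ nVQ; have [qp1 | nqp1] := boolP (q %| p.-1); first by right.
left; rewrite -ker_conj_aut ker_trivg_morphim nVQ /=.
have cycV : cyclic V by rewrite prime_cyclic ?oV.
rewrite subG1 trivg_card1; apply/eqP; apply: (@pnat_1 q); first exact: morphim_pgroup.
have sQA : conj_aut V @* Q \subset Aut V.
  by apply: subset_trans (morphimS _ _) (Aut_conj_aut _ _); apply: subxx.
apply: pnat_dvd (cardSg sQA) _; rewrite card_Aut_cyclic // oV totient_prime //.
by rewrite p'natE.
Qed.

(** In a coprime action on an abelian group, [A] has no nontrivial fixed point in [[~: V, A]]; here
    all of [[~: V, A]] is fixed, so it is trivial. *)
Lemma coprime_stable_cent (gT : finGroupType) (V W A : {group gT}) :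
    abelian V -> coprime #|V| #|A| -> A \subset 'N(V) ->
    A \subset 'C(W) -> [~: V, A] \subset W ->
  A \subset 'C(V).
Proof.
move=> abV coVA nVA cWA sVAW; rewrite centsC; apply/commG1P.
rewrite -(coprime_abel_cent_TI nVA coVA abV); apply/esym/setIidPl.
by rewrite (subset_trans sVAW) // centsC.
Qed.

(** Induction on [#|V|]: a maximal proper modular [M] above [Q] is [V1 <*> Q] with [V1 < V], and the
    result for [V1] is lifted to [V]. If [M] is normal, [[~: V, Q]] lies in [V1]. Otherwise
    ['Phi(Q)] lies in the core of [M], and [V / V1] has order [p]. *)
Lemma submodular_pgroup_act (gT : finGroupType) (p q : nat) (V Q : {group gT}) :
    prime p -> prime q -> p != q -> p.-group V -> abelian V -> q.-group Q ->
    Q \subset 'N(V) -> submodular Q (V <*> Q)%G ->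
  'Phi(Q) \subset 'C(V) /\ (Q \subset 'C(V) \/ q %| p.-1).
Proof.
move=> p_pr q_pr neq_pq; have [n] := ubnP #|V|.
elim: n V => // n IHn V /ltnSE-leVn pV abV qQ nVQ subQ.
have coVQ : coprime #|V| #|Q|.
  by apply: (@pnat_coprime p); rewrite // (pi_pnat qQ) // !inE eq_sym.
set L := (V <*> Q)%G in subQ.
have sVL : V \subset L := joing_subl V Q; have sQL : Q \subset L := joing_subr V Q.
(* By coprimality [V \subset Q] forces [V = 1]; otherwise [Q] is proper in [L]. *)
have [sVQ | nsVQ] := boolP (V \subset Q).
  suffices -> : V :=: 1 by rewrite !cents1; split; last left.
  by apply/eqP; rewrite trivg_card1 -(setIidPl sVQ) coprime_TIg ?cards1.
have [|M maxM sQM] := max_modular_exists subQ.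
  by rewrite properE sQL; apply: contra nsVQ; apply: subset_trans.
have sML := proper_sub (max_modular_proper maxM).
pose V1 := (V :&: M)%G.
have nV1Q : Q \subset 'N(V1) by rewrite normsI // normsG.
have nsVM : ~~ (V \subset M).
  apply: contraL (max_modular_proper maxM) => sVM.
  by rewrite properE join_subG sVM sQM andbF.
have defM : (V1 <*> Q)%G = M.
  apply: val_inj; rewrite /= norm_joinEr // /V1 /= setIC group_modr // -norm_joinEr //.
  exact/setIidPl.
have [||||||IHphi IHQ] := IHn V1; rewrite ?defM //.
- apply: leq_trans leVn; rewrite proper_card //.
  by rewrite properE subsetIl subsetI subxx.
- exact: pgroupS (subsetIl V M) pV.
- exact: abelianS (subsetIl V M) abV.
- exact: submodular_subgroup subQ sQM sML.
have sphiQ := Phi_sub Q.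
have sphiV (A : {group gT}) : A \subset Q -> [~: V, A] \subset V.
  by move=> sAQ; rewrite commg_subl (subset_trans sAQ).
have centV (A : {group gT}) : A \subset Q -> A \subset 'C(V1) -> [~: V, A] \subset M ->
    A \subset 'C(V).
  move=> sAQ cV1A sVAM; apply: coprime_stable_cent abV _ _ cV1A _.
  - exact: coprimegS coVQ.
  - exact: subset_trans nVQ.
  by rewrite subsetI sphiV.
have [nsML | not_nsML] := boolP (M <| L).
  have nMV : V \subset 'N(M) := subset_trans sVL (normal_norm nsML).
  have sVQM : [~: V, Q] \subset M.
    by apply: subset_trans (commgS V sQM) _; rewrite commg_subr.
  split; last by case: IHQ => [cV1Q | qp1]; [left; apply: centV | right].
  by apply: centV => //; apply: subset_trans (commgS V sphiQ) sVQM.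
split.
  apply: centV => //; apply: subset_trans (gcore_sub M L).
  apply: subset_trans (commgS V (max_modular_Phi maxM not_nsML sQL)) _.
  by rewrite commg_subr (subset_trans sVL) ?gcore_norm.
case: IHQ => [cV1Q | qp1]; last by right.
have maxV1 := max_modular_setI maxM not_nsML sVL nsVM.
have nsV1V : V1 <| V by apply: p_maximal_normal pV maxV1.
have oV : #|V / V1| = p by rewrite card_quotient ?normal_norm ?(p_maximal_index pV).
have nV1V := normal_norm nsV1V.
have qQb : q.-group (Q / V1) by apply: quotient_pgroup.
have [cVQ | ] := pgroup_norm_prime_cent p_pr q_pr oV qQb (quotient_norms _ nVQ).
  left; apply: centV => //; apply: subset_trans (subsetIr V M).
  by rewrite -quotient_cents2 // centsC.
by right.
Qed.

(** * Burnside's transfer argument *)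

Section Burnside.

Variables (gT : finGroupType) (q : nat) (G P : {group gT}).
Hypotheses (sylP : q.-Sylow(G) P) (cNP : 'N_G(P) \subset 'C(P)).

Let sPG : P \subset G := pHall_sub sylP.

Let abP : abelian P.
Proof. by apply: subset_trans cNP; rewrite subsetI sPG normG. Qed.

(** Both [P] and [P :^ x^-1] are Sylow in ['C_G[h]], so some [c] there carries the first to the
    second; then [c * x] normalises [P], hence centralises [h]. *)
Lemma burnside_fusion h x : h \in P -> x \in G -> h ^ x \in P -> h ^ x = h.
Proof.
move=> Ph Gx Phx; have Gh := subsetP sPG h Ph.
have cPh : P \subset 'C_G[h] by rewrite subsetI sPG sub_cent1 (subsetP abP).
have sylPx : q.-Sylow(G) (P :^ x^-1) by rewrite pHallJ ?groupV.
have cPxh : P :^ x^-1 \subset 'C_G[h].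
  rewrite subsetI (pHall_sub sylPx) /= sub_conjgV -cent1J sub_cent1.
  exact: subsetP abP _ Phx.
have sCG : 'C_G[h] \subset G := subsetIl _ _.
have [c /setIP[Gc Cc] eP] :=
  Sylow_trans (pHall_subl cPh sCG sylP) (pHall_subl cPxh sCG sylPx).
have Ncx : c * x \in 'N_G(P).
  by rewrite inE groupM //=; apply/normP; rewrite conjsgM -eP conjsgKV.
have /commute_sym/commgP/conjg_fixP := centP (subsetP cNP _ Ncx) h Ph.
by rewrite conjgM (_ : h ^ c = h) //; apply/conjg_fixP/commgP/commute_sym/cent1P.
Qed.

Let idP := idm_morphism P.
Let abA : abelian (idP @* P).
Proof. by rewrite morphim_idm ?subxx. Qed.

(** Each cycle of [<[g]>] on the cosets of [P] contributes a conjugate of a power of [g] lying in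
    [P], which by fusion is that power itself; the cycle lengths add up to [#|G : P|]. *)
Lemma burnside_transfer g : g \in P -> transfer G abA g = FiniteModule.fmod abA (g ^+ #|G : P|).
Proof.
move=> Pg; have Gg := subsetP sPG g Pg.
have trX := transversalP (rcosets_cycle_partition sPG Gg).
rewrite (transfer_cycle_expansion sPG abA Gg trX).
rewrite -(sum_index_rcosets_cycle sPG Gg trX).
have Pgn n : g ^+ n \in P by rewrite groupX.
have PA n : g ^+ n \in idP @* P by rewrite morphim_idm ?subxx.
rewrite (big_morph (fun n => FiniteModule.fmod abA (g ^+ n))
  (op1 := +%R) (id1 := 0%R)); last 2 first.
- by move=> m n /=; rewrite expgD FiniteModule.fmodM.
- exact: FiniteModule.fmod1.
apply: eq_bigr => x /(subsetP (transversal_sub trX)) Gx.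
set n := #|_ : _|; congr (FiniteModule.fmod abA).
rewrite /= /idm; apply: burnside_fusion; rewrite ?groupV //.
rewrite conjgE invgK mulgA -mem_rcoset.
exact: mulg_exp_card_rcosets.
Qed.

(** The transfer kernel is [1] or [G]. In the first case [G] embeds in an abelian group; in the
    second every element of [P] is killed by [#|G : P|], which is coprime to [#|P|], so [P = 1]. *)
Lemma simple_burnside_abelian : P :!=: 1 -> simple G -> abelian G.
Proof.
move=> ntP /simpleP[_ simG].
case: (simG ('ker (transfer_morphism G abA))%G); first exact: ker_normal.
  move=> ker1.
  have injV : 'injm (transfer_morphism G abA) by rewrite ker1.
  rewrite -(injm_abelian injV) //.
  by apply: FinRing.zmod_abelian.
move=> kerG; case/eqP: ntP; apply/trivgP/subsetP=> g Pg.
have Gg := subsetP sPG g Pg.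
have := mker (_ : g \in 'ker (transfer_morphism G abA)).
rewrite kerG => /(_ Gg) /=; rewrite burnside_transfer // => gm.
have PA n : g ^+ n \in idP @* P by rewrite morphim_idm ?subxx ?groupX.
have {}gm : g ^+ #|G : P| = 1.
  by rewrite -(FiniteModule.fmodK abA (PA _)) gm.
have coP : coprime #|P| #|G : P| by case/and3P: sylP => _ pP; apply: pnat_coprime.
by rewrite inE -(expgK coP Pg) gm expg1n.
Qed.

End Burnside.

(** * Groups with submodular Sylow subgroups *)

(** A Sylow subgroup of [U] is the intersection with [U] of a Sylow subgroup of [G]. *)
Lemma sylow_submodular_subgroup (gT : finGroupType) (G U : {group gT}) :
  U \subset G -> sylow_submodular G -> sylow_submodular U.
Proof.
move=> sUG FG q P q_pr sylP; have [sPU qP _] := and3P sylP.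
have [R sylR sPR] := Sylow_superset (subset_trans sPU sUG) qP.
have := submodular_setI U (FG q R q_pr sylR).
congr submodular; apply: val_inj => /=; last exact/setIidPr.
apply: sub_pHall sylP _ _ _; rewrite ?subsetIr ?subsetI ?sPR //.
by apply: pgroupS (subsetIl _ _) (pHall_pgroup sylR).
Qed.

Lemma morphim_Sylow_lift (q : nat) (aT rT : finGroupType) (D G : {group aT})
    (f : {morphism D >-> rT}) (Q : {group rT}) :
    G \subset D -> q.-Sylow(f @* G) Q ->
  exists2 P : {group aT}, q.-Sylow(G) P & Q :=: f @* P.
Proof.
move=> sGD sylQ; have [P sylP] := Sylow_exists q G.
have sPD := subset_trans (pHall_sub sylP) sGD.
have [_ /morphimP[x Dx Gx ->] ->] := Sylow_trans (morphim_pHall f sPD sylP) sylQ.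
by exists (P :^ x)%G; rewrite ?pHallJ // morphimJ.
Qed.

Lemma sylow_submodular_morphim (aT rT : finGroupType) (D G : {group aT})
    (f : {morphism D >-> rT}) :
  G \subset D -> sylow_submodular G -> sylow_submodular (f @* G)%G.
Proof.
move=> sGD FG q Q q_pr /(morphim_Sylow_lift sGD)[P sylP eQ].
have -> : Q = (f @* P)%G by apply: val_inj.
exact: submodular_morphim (FG q P q_pr sylP).
Qed.

Lemma sylow_submodular_quotient (gT : finGroupType) (G N : {group gT}) :
  G \subset 'N(N) -> sylow_submodular G -> sylow_submodular (G / N)%G.
Proof. exact: sylow_submodular_morphim. Qed.

Lemma sylow_submodular_act (gT : finGroupType) (p q : nat) (G V Q : {group gT}) :
    sylow_submodular G -> prime p -> prime q -> p != q ->
    V \subset G -> p.-group V -> abelian V -> Q \subset 'N(V) -> q.-Sylow(G) Q ->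
  'Phi(Q) \subset 'C(V) /\ (Q \subset 'C(V) \/ q %| p.-1).
Proof.
move=> FG p_pr q_pr neq_pq sVG pV abV nVQ sylQ; have [sQG qQ _] := and3P sylQ.
apply: submodular_pgroup_act => //.
by apply: submodular_subgroup (FG q Q q_pr sylQ) _ _; rewrite ?joing_subr // join_subG sVG.
Qed.

(* For p the smallest prime divisor of |G|, no prime divisor of |G| divides p - 1,
   so 'N_G(P) centralises the abelian Sylow p-subgroup P. *)
Lemma sylow_submodular_simple_abelian (gT : finGroupType) (G : {group gT}) :
  sylow_submodular G -> simple G -> abelian G.
Proof.
move=> FG simG; have [ntG simGP] := simpleP _ simG.
pose p := pdiv #|G|; have G_gt1 : 1 < #|G| by rewrite cardG_gt1.
have p_pr : prime p by apply: pdiv_prime.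
have [P sylP] := Sylow_exists p G; have [sPG pP _] := and3P sylP.
have ntP : P :!=: 1.
  by rewrite -rank_gt0 (rank_Sylow sylP) p_rank_gt0 pi_pdiv.
have [sGP | nsGP] := boolP (G \subset P).
  have solG : solvable G by apply: (pgroup_sol (p := p)); apply: pgroupS sGP pP.
  by apply/cyclic_abelian/prime_cyclic/simple_sol_prime.
have [|M maxM sPM] := max_modular_exists (FG p P p_pr sylP); first by rewrite properE sPG.
have ltMG := max_modular_proper maxM.
(* Simplicity makes [M] non-normal with trivial core, so ['Phi(P) = 1] and [P] is elementary
   abelian. *)
have not_nMG : ~~ (M <| G).
  apply/negP=> /simGP[] eM; last by rewrite eM properxx in ltMG.
  by case/eqP: ntP; apply/trivgP; rewrite -eM.
have core1 : gcore M G = 1.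
  case: (simGP (gcore M G)%G) => //=.
    by rewrite gcore_normal // proper_sub.
  by move=> eM; case/andP: ltMG => _; rewrite -{1}eM gcore_sub.
have abP : abelian P.
  apply: (@abelem_abelian _ p); rewrite -trivg_Phi // -subG1 -core1.
  exact: max_modular_Phi.
apply: (simple_burnside_abelian sylP) => //.
rewrite -(Sylow_gen 'N_G(P)%G) gen_subG.
apply/bigcupsP=> Q /SylowP[q q_pr sylQ]; have [sQN qQ _] := and3P sylQ.
have FN : sylow_submodular 'N_G(P)%G by apply: sylow_submodular_subgroup FG; apply: subsetIl.
have sPN : P \subset 'N_G(P) by rewrite subsetI sPG normG.
have [epq | neq_pq] := eqVneq p q.
  rewrite -epq in qQ.
  have nsPN : P <| 'N_G(P) by rewrite /normal sPN subsetIr.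
  have sylPN : p.-Sylow('N_G(P)) P by apply: pHall_subl sylP; rewrite ?subsetIl.
  by apply: subset_trans abP; rewrite (sub_normal_Hall sylPN).
have nPQ : Q \subset 'N(P) by apply: subset_trans sQN (subsetIr _ _).
have [_ [//|qp1]] := sylow_submodular_act FN p_pr q_pr neq_pq sPN pP abP nPQ sylQ.
have [-> | ntQ] := eqVneq Q 1%G; first exact: sub1G.
have [_ qQ1 _] := pgroup_pdiv qQ ntQ.
have : p <= q.
  apply: pdiv_min_dvd (prime_gt1 q_pr) (dvdn_trans qQ1 _).
  by apply: cardSg; apply: subset_trans sQN (subsetIl _ _).
have p1_gt0 : 0 < p.-1 by rewrite -subn1 subn_gt0 prime_gt1.
by rewrite leqNgt -(prednK (prime_gt0 p_pr)) ltnS (dvdn_leq p1_gt0 qp1).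
Qed.

Lemma sylow_submodular_solvable (gT : finGroupType) (G : {group gT}) :
  sylow_submodular G -> solvable G.
Proof.
have [n] := ubnP #|G|; elim: n gT G => // n IHn gT G /ltnSE-leGn FG.
have [-> | ntG] := eqVneq G 1%G; first exact: solvable1.
have [M minM sMG] := minnormal_exists ntG (normG G).
(* [minnormal G G] is by definition [simple G]. *)
have [eMG | neMG] := eqVneq M G.
  by rewrite eMG in minM; apply/abelian_sol/sylow_submodular_simple_abelian.
have [/andP[ntM nMG] _] := mingroupP minM.
have nsMG : M <| G by apply/andP.
rewrite (series_sol nsMG) !IHn //.
- apply: leq_trans leGn; exact: ltn_quotient.
- exact: sylow_submodular_quotient.
- by apply: leq_trans leGn; rewrite proper_card // properEneq neMG.
exact: sylow_submodular_subgroup FG.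
Qed.

(** Otherwise choose [K / Z] minimal normal in [G / Z] inside ['C_G(F) / Z], with
    [Z = 'C_G(F) :&: F]. It is abelian and [Z] is central in [K], so [K] is nilpotent and normal,
    hence contained in [F]. *)
Lemma cent_Fitting_sub (gT : finGroupType) (G : {group gT}) :
  solvable G -> 'C_G('F(G)) \subset 'F(G).
Proof.
move=> solG; set F := 'F(G); apply/idPn=> nsCF.
have nsFG : F <| G := Fitting_normal G.
have nsCG : 'C_G(F) <| G.
  by rewrite /normal subsetIl normsI ?normG // norms_cent // normal_norm.
pose Z := ('C_G(F) :&: F)%G.
have nsZG : Z <| G by apply: normalI.
have nZC : 'C_G(F) \subset 'N(Z) := subset_trans (normal_sub nsCG) (normal_norm nsZG).
have ntCZ : ('C_G(F) / Z)%G != 1%G.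
  by rewrite -val_eqE /= -subG1 quotient_sub1 // subsetI subxx.
have nCZ : G / Z \subset 'N('C_G(F) / Z) by rewrite quotient_norms ?normal_norm.
have [Kb minKb sKbC] := minnormal_exists ntCZ nCZ.
have sKbG : Kb \subset G / Z := subset_trans sKbC (quotientS Z (normal_sub nsCG)).
have [nKbG ntKb /is_abelemP[r _ /abelem_abelian abKb]] :=
  minnormal_solvable minKb sKbG (quotient_sol Z solG).
have nsKb : Kb <| G / Z by apply/andP.
have [K eK sZK nsKG] := inv_quotientN nsZG nsKb.
have nZK : K \subset 'N(Z) := subset_trans (normal_sub nsKG) (normal_norm nsZG).
have sKC : K \subset 'C_G(F).
  by rewrite -(quotientSGK nZK (subsetIl _ _)) -eK.
have cKF : K \subset 'C(F) by apply: subset_trans sKC (subsetIr _ _).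
have sZK' : Z \subset 'Z(K).
  rewrite subsetI sZK /= centsC (subset_trans cKF) //.
  by rewrite centS // subsetIr.
have nilK : nilpotent K.
  rewrite -quotient_center_nil abelian_nil // sub_der1_abelian //.
  by apply: subset_trans sZK'; rewrite der1_min // -eK.
case/negP: ntKb; rewrite eK -subG1 quotient_sub1 // subsetI sKC.
exact: Fitting_max.
Qed.

(** The exponent of a q-group is a power of [q], so squarefree means dividing [q]. *)
Lemma prime_pgroup_exponentP (gT : finGroupType) (p q : nat) (Q : {group gT}) :
    prime q -> q.-group Q ->
  abelian_exponent_dvd p.-1 Q /\ abelian_squarefree_exponent Q <->
  abelian Q /\ exponent Q %| gcdn q p.-1.
Proof.
move=> q_pr qQ; split=> [[[abQ expp] [_ sqf]] | [abQ]].
  split=> //; rewrite dvdn_gcd expp andbT.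
  have /(p_natP) [k ek] : q.-nat (exponent Q) by rewrite -pnat_exponent in qQ.
  have := sqf q q_pr; rewrite ek (dvdn_Pexp2l _ _ (prime_gt1 q_pr)) -ltnNge ltnS => k1.
  by rewrite -{2}(expn1 q) dvdn_exp2l.
rewrite dvdn_gcd => /andP[expq expp]; split=> //; split=> // l l_pr.
apply/negP=> /dvdn_trans/(_ expq) l2q.
have : l %| q by apply: dvdn_trans l2q; rewrite dvdn_exp.
rewrite dvdn_prime2 // => /eqP el; move: l2q.
by rewrite el -{2}(expn1 q) (dvdn_Pexp2l _ _ (prime_gt1 q_pr)).
Qed.

Lemma quotient_Phi_exponent (gT : finGroupType) (q : nat) (Q C : {group gT}) :
    q.-group Q -> Q \subset 'N(C) -> 'Phi(Q) \subset C ->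
  abelian (Q / C) /\ exponent (Q / C) %| q.
Proof.
move=> qQ nCQ sPhiC.
have abelQ := Phi_quotient_abelem qQ.
have [ab1 exp1] : abelian (Q / 'Phi(Q)) /\ exponent (Q / 'Phi(Q)) %| q.
  by case/and3P: abelQ.
split.
  apply: sub_der1_abelian; apply: subset_trans sPhiC.
  by rewrite der1_min // gFnorm.
apply/exponentP=> _ /morphimP[x Nx Qx ->].
have Nphi : x \in 'N('Phi(Q)) by apply: subsetP Qx; apply: gFnorm.
rewrite -morphX //; apply: coset_id; apply: (subsetP sPhiC).
apply: coset_idr; rewrite ?groupX // morphX //.
exact: (exponentP exp1) (mem_quotient _ Qx).
Qed.

(** Write the p-core as [O / C] with [O] in [C * P], where [P] is a Sylow p-subgroup of [O]. The
    p-group [V <*> P] has central elements in [V], so ['C_V(O)] is nontrivial; being G-invariant, it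
    is [V]. *)
Lemma minnormal_pcore_quotient_cent (gT : finGroupType) (p : nat) (G V : {group gT}) :
  minnormal V G -> p.-group V -> 'O_p(G / 'C_G(V)) = 1.
Proof.
move=> minV pV; have [/andP[ntV nVG] minVP] := mingroupP minV.
pose C := 'C_G(V)%G; change ('O_p(G / C) = 1).
have nsCG : C <| G by rewrite /normal subsetIl normsI ?normG ?norms_cent.
have [O eO sCO nsOG] := inv_quotientN nsCG (pcore_normal p (G / C)).
have [sOG nOG] := andP nsOG.
have nCO : O \subset 'N(C) := subset_trans sOG (normal_norm nsCG).
have [P sylP] := Sylow_exists p O; have [sPO pP _] := and3P sylP.
have nCP := subset_trans sPO nCO.
have eP : P / C = O / C.
  apply: (pHall_id (quotient_pHall nCP sylP)).
  by move: (pcore_pgroup p (G / C)); rewrite eO.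
have sOCP : O \subset C * P by rewrite -quotientSK // eP.
have nVP : P \subset 'N(V) := subset_trans sPO (subset_trans sOG nVG).
have nilVP : nilpotent (V <*> P).
  by apply: (@pgroup_nil _ p); rewrite /= norm_joinEr // pgroupM pV.
have nsVVP : V <| V <*> P by rewrite normalYl.
have nt := meet_center_nil nilVP nsVVP ntV.
have ntCVO : 'C_V(O) != 1.
  apply: subG1_contra nt; rewrite subsetI subsetIl centsC (subset_trans sOCP) //.
  rewrite mul_subG //.
    by rewrite centsC (subset_trans (subsetIl _ _)) // centsC subsetIr.
  rewrite centsC (subset_trans (subsetIr _ _)) // (subset_trans (subsetIr _ _)) //.
  by rewrite centS // joing_subr.
have eCVO : 'C_V(O) = V.
  apply: (minVP 'C_V(O)%G); last exact: subsetIl.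
  by rewrite ntCVO normsI // norms_cent.
apply/trivgP; rewrite eO quotient_sub1 // subsetI sOG centsC.
by apply/setIidPl.
Qed.

(** * Chief factors *)

Lemma minnormal_abelem_prime (gT : finGroupType) (p : nat) (G V : {group gT}) :
    minnormal V G -> V \subset G -> solvable V -> prime p -> p %| #|V| ->
  p.-abelem V.
Proof.
move=> minV sVG solV p_pr pV.
have [_ _ /is_abelemP[r r_pr abelV]] := minnormal_solvable minV (subxx V) solV.
have /(p_natP) [k eV] := abelem_pgroup abelV.
by move: pV; rewrite eV Euclid_dvdX // dvdn_prime2 // => /andP[/eqP-> _].
Qed.

Section ChiefScreen.

Variables (gT : finGroupType) (p : nat) (G V : {group gT}).
Hypotheses (FG : sylow_submodular G) (minV : minnormal V G) (sVG : V \subset G).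
Hypotheses (p_pr : prime p) (pV : p %| #|V|).

Let solG : solvable G := sylow_submodular_solvable FG.
Let abelV : p.-abelem V :=
  minnormal_abelem_prime minV sVG (solvableS sVG solG) p_pr pV.
Let nVG : G \subset 'N(V).
Proof. by case/mingroupP: minV => /andP[]. Qed.
Let C := 'C_G(V)%G.
Let nsCG : C <| G.
Proof. by rewrite /normal subsetIl normsI ?normG ?norms_cent. Qed.
Let nCG : G \subset 'N(C) := normal_norm nsCG.

Lemma chief_p'_Sylow (q : nat) (Q : {group coset_of C}) :
    prime q -> p != q -> q.-Sylow(G / C) Q ->
  abelian Q /\ exponent Q %| gcdn q p.-1.
Proof.
move=> q_pr neq_pq /(morphim_Sylow_lift nCG)[P sylP ->]; rewrite -quotientE.
have [sPG qP _] := and3P sylP; have nCP := subset_trans sPG nCG.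
have [cPhi cP] := sylow_submodular_act FG p_pr q_pr neq_pq sVG
  (abelem_pgroup abelV) (abelem_abelian abelV) (subset_trans sPG nVG) sylP.
have sPhiC : 'Phi(P) \subset C by rewrite subsetI (subset_trans (Phi_sub _)).
have [abP expP] := quotient_Phi_exponent qP nCP sPhiC.
split=> //; rewrite dvdn_gcd expP /=.
case: cP => [cVP | qp1]; last exact: dvdn_trans qp1.
suffices -> : P / C = 1 by rewrite exponent1.
by apply/trivgP; rewrite quotient_sub1 // subsetI sPG.
Qed.

(** If [P] failed to centralise ['O_q(G / C)] with [q != p], then [p] would divide [q - 1] while [q]
    divides [p - 1]. So [P] centralises the Fitting subgroup, lies in it, and is in the trivial
    p-core. *)
Lemma chief_Sylow_trivial (P : {group coset_of C}) : p.-Sylow(G / C) P -> P :=: 1.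
Proof.
move=> sylP; have [sPA pP _] := and3P sylP.
have FA := sylow_submodular_quotient nCG FG.
have solA : solvable (G / C) := quotient_sol C solG.
have cFP : 'F(G / C) \subset 'C(P).
  rewrite FittingEgen gen_subG; apply/bigcupsP=> -[q _] /= /[!mem_primes].
  case/and3P=> q_pr _ _; rewrite centsC.
  have [epq | neq_pq] := eqVneq p q.
    rewrite -epq (_ : 'O_p(G / C) = 1) ?cents1 //.
    exact: minnormal_pcore_quotient_cent (abelem_pgroup abelV).
  have [Q sylQ] := Sylow_exists q (G / C).
  have [abQ expQ] := chief_p'_Sylow q_pr neq_pq sylQ.
  have sOQ : 'O_q(G / C) \subset Q := pcore_sub_Hall sylQ.
  have sOA := pcore_sub q (G / C).
  have nOP : P \subset 'N('O_q(G / C)) := subset_trans sPA (gFnorm _ _).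
  have neq_qp : q != p by rewrite eq_sym.
  (* The primes exchange roles: the p-group [P] acts on an abelian q-group. *)
  have [_ [// | pq1]] := sylow_submodular_act FA q_pr p_pr neq_qp
    sOA (pcore_pgroup q _) (abelianS sOQ abQ) nOP sylP.
  have [-> | ntO] := eqsVneq 'O_q(G / C) 1; first exact: cents1.
  have ntQ : Q :!=: 1 by apply: subG1_contra ntO.
  have [_ qQ1 _] := pgroup_pdiv (pHall_pgroup sylQ) ntQ.
  have : q %| p.-1.
    move: expQ; rewrite dvdn_gcd => /andP[_]; apply: dvdn_trans.
    have [x Qx ox] := Cauchy q_pr qQ1.
    by rewrite -ox dvdn_exponent.
  have p1_gt0 : 0 < p.-1 by rewrite -subn1 subn_gt0 prime_gt1.
  have q1_gt0 : 0 < q.-1 by rewrite -subn1 subn_gt0 prime_gt1.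
  move/(dvdn_leq p1_gt0); move/(dvdn_leq q1_gt0): pq1.
  rewrite -ltnS prednK ?prime_gt0 // => lt_pq; rewrite -ltnS prednK ?prime_gt0 //.
  by rewrite ltnNge ltnW.
have sPF : P \subset 'F(G / C).
  by apply: subset_trans (cent_Fitting_sub solA); rewrite subsetI sPA centsC.
have := pP; rewrite -(sub_Hall_pcore (nilpotent_pcore_Hall p (Fitting_nil _)) sPF).
rewrite p_core_Fitting (minnormal_pcore_quotient_cent minV (abelem_pgroup abelV)).
by move/trivgP.
Qed.

Lemma chief_sylow_screen : sylow_screen p (G / C)%G.
Proof.
split=> [|q Q q_pr sylQ]; first exact: quotient_sol.
apply/(prime_pgroup_exponentP p q_pr (pHall_pgroup sylQ)).
have [epq | neq_pq] := eqVneq p q; last exact: chief_p'_Sylow sylQ.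
rewrite -epq in sylQ; rewrite (chief_Sylow_trivial sylQ) abelian1 exponent1.
by split.
Qed.

End ChiefScreen.

(** * From the action on chief factors to submodularity *)

Section AbelemEigenvector.

Local Open Scope ring_scope.

(** Without eigenvalues every [A - c%:M] would be invertible, and so would their product, which is
    zero; the size [n.+1] makes the matrix ring nontrivial. *)
Lemma Fp_matrix_eigenvalue (p n : nat) (A : 'M['F_p]_n.+1) :
  prime p -> A ^+ p = A -> exists c : 'F_p, eigenvalue A c.
Proof.
move=> p_pr ApA.
have [c evc | noev] := pickP (eigenvalue A); first by exists c.
(* The product of all A - c is A ^+ p - A = 0. *)
have prod0 : \prod_(c : 'F_p) (A - c%:M) = 0.
  transitivity (horner_mx A (\prod_(c : 'F_p) ('X - c%:P))).
    by rewrite rmorph_prod; apply: eq_bigr => c _; rewrite rmorphB /= horner_mx_X horner_mx_C.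
  by rewrite -finField_genPoly rmorphB rmorphXn /= horner_mx_X card_Fp // ApA subrr.
suffices : \prod_(c : 'F_p) (A - c%:M) \is a GRing.unit by rewrite prod0 unitr0.
apply: rpred_prod => c _.
have := noev c; rewrite /eigenvalue /eigenspace => /negbFE.
by rewrite kermx_eq0 row_free_unit.
Qed.

End AbelemEigenvector.

Lemma abelem_eigenvector (gT : finGroupType) (p : nat) (E : {group gT}) (x : gT) :
    prime p -> p.-abelem E -> E :!=: 1 -> x \in 'N(E) -> x ^+ p.-1 \in 'C(E) ->
  exists w, exists k, [/\ w \in E, w != 1 & w ^ x = w ^+ k].
Proof.
move=> p_pr abelE ntE Nx Cxp.
have nEX : <[x]> \subset 'N(E) by rewrite cycle_subG.
pose rX := abelem_repr abelE ntE nEX; have Xx := cycle_id x.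
have xp1 : (rX x ^+ p.-1 = 1)%R.
  have : x ^+ p.-1 \in rker rX by rewrite rker_abelem inE mem_cycle.
  by case/rkerP=> _; rewrite repr_mxX.
have [|c] := @Fp_matrix_eigenvalue p _ (rX x) p_pr.
  by have := exprS (rX x) p.-1; rewrite xp1 mulr1 prednK ?prime_gt0.
case/eigenvalueP=> v evc ntv.
(* The eigenvalue [c] in ['F_p] is read as a natural number exponent. *)
exists (rVabelem abelE ntE v); exists c; split.
- exact: mem_rVabelem.
- by rewrite -(rVabelem0 abelE ntE) (inj_eq (@rVabelem_inj _ _ _ abelE ntE)).
by rewrite -rVabelemZ -evc rVabelemJ.
Qed.

(** By irreducibility each element of [Q] acts on [W] as a power map, so every cyclic subgroup of
    [W] is invariant and [W] itself is cyclic. *)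
Lemma minnormal_abelem_order (gT : finGroupType) (p : nat) (W Q : {group gT}) :
    prime p -> p.-abelem W -> minnormal W Q -> Q^`(1) \subset 'C(W) ->
    {in Q, forall x, x ^+ p.-1 \in 'C(W)} ->
  #|W| = p.
Proof.
move=> p_pr abelW minW cQ'W expQ; have [/andP[ntW nWQ] minWP] := mingroupP minW.
have abW := abelem_abelian abelW.
have powQ x : x \in Q -> exists k, {in W, forall w, w ^ x = w ^+ k}.
  move=> Qx; have Nx := subsetP nWQ x Qx.
  have [w [k [Ww ntw ewx]]] := abelem_eigenvector p_pr abelW ntW Nx (expQ x Qx).
  (* The eigenspace S of x is Q-invariant, as Q acts on W as an abelian group. *)
  exists k; pose S := [set u in W | u ^ x == u ^+ k].
  have gS : group_set S.
    apply/group_setP; split; first by rewrite inE group1 conj1g expg1n eqxx.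
    move=> u v /setIdP[Wu /eqP eu] /setIdP[Wv /eqP ev].
    rewrite inE groupM // conjMg eu ev expgMn ?eqxx //.
    exact: (centsP abW).
  have eS : S = W.
    apply: (minWP (group gS)); last by apply/subsetP=> u /setIdP[].
    apply/andP; split.
      by apply/trivgPn; exists w; rewrite // inE Ww ewx eqxx.
    apply/subsetP=> y Qy; rewrite inE; apply/subsetP=> _ /imsetP[u /setIdP[Wu /eqP eu] ->].
    have Ny := subsetP nWQ y Qy.
    rewrite inE memJ_norm // Wu -conjXg -eu -!conjgM /= (commgC x y) (conjgM u (y * x)).
    have Wuyx : u ^ (y * x) \in W by rewrite memJ_norm ?groupM.
    have cxy := subsetP cQ'W _ (mem_commg Qx Qy).
    rewrite eq_sym; apply/eqP/conjg_fixP/commgP/commute_sym.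
    exact: (centP cxy).
  by move=> u; rewrite -eS => /setIdP[_ /eqP].
have [w Ww ntw] := trivgPn _ ntW.
have <- : <[w]> = W.
  apply: (minWP <[w]>%G); last by rewrite cycle_subG.
  rewrite cycle_eq1 ntw /=; apply/subsetP=> x Qx.
  have [k ek] := powQ x Qx; rewrite inE -cycleJ cycle_subG ek //.
  exact: mem_cycle.
exact: abelem_order_p abelW Ww ntw.
Qed.

(** Unless [Q] centralises [W] and is normal, factor out [C]: [Q / C] embeds in the cyclic group
    [Aut W] and has exponent dividing [q], so its order is [q]. Its index in [L / C] is [p], and
    [modular_prime] applies. *)
Lemma submodular_normal_prime (gT : finGroupType) (p q : nat) (W Q : {group gT}) :
    prime p -> prime q -> p != q -> #|W| = p -> q.-group Q -> Q \subset 'N(W) ->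
    {in Q, forall x, x ^+ q \in 'C(W)} ->
  modular_in Q (W <*> Q)%G.
Proof.
move=> p_pr q_pr neq_pq oW qQ nWQ expQ; set L := (W <*> Q)%G.
have sWL : W \subset L := joing_subl W Q; have sQL : Q \subset L := joing_subr W Q.
have coWQ : coprime #|W| #|Q|.
  by rewrite oW prime_coprime // -p'natE // (pi_pnat qQ) // !inE eq_sym.
have oL : #|L| = (p * #|Q|)%N by rewrite /= norm_joinEr // coprime_cardMg // oW.
pose C := 'C_Q(W)%G.
have sCQ : C \subset Q := subsetIl _ _.
have nsCQ : C <| Q by rewrite /normal sCQ normsI ?normG ?norms_cent.
have nsCL : C <| L.
  rewrite /normal (subset_trans sCQ) // join_subG (normal_norm nsCQ) andbT.
  by rewrite cents_norm // centsC subsetIr.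
have [sQC | nsQC] := boolP (Q \subset C).
  apply: modular_normal; suffices -> : Q = C by [].
  by apply/eqP; rewrite -val_eqE eqEsubset sQC.
apply: (modular_preim nsCL) => //.
have nCQ := normal_norm nsCQ; have nCL := normal_norm nsCL.
have cycQC : cyclic (Q / C).
  have := first_isog_loc (conj_aut_morphism W) nWQ.
  rewrite /= ker_conj_aut => /isog_cyclic ->.
  by apply: cyclicS (Aut_conj_aut W Q) _; rewrite Aut_prime_cyclic ?oW.
have oQC : #|Q / C| = q.
  apply/prime_nt_dvdP=> //; first by rewrite -trivg_card1 -subG1 quotient_sub1.
  rewrite -exponent_cyclic //; apply/exponentP=> _ /morphimP[x Nx Qx ->].
  by rewrite -morphX //; apply: coset_id; rewrite inE groupX ?expQ.
apply: modular_prime; rewrite ?oQC //; first exact: quotientS.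
have -> : #|(L / C)%G : Q / C| = #|L : Q|.
  by apply: index_quotient_eq => //; apply: subset_trans (subsetIr _ _) sCQ.
by rewrite -divgS // oL mulnK ?cardG_gt0.
Qed.

(** Induction on [#|V|]: a minimal Q-invariant [W] in [V] has order [p], so [Q] is modular in
    [W <*> Q], and the rest of the chain comes from the quotient by [W]. *)
Lemma submodular_of_pgroup_act (gT : finGroupType) (p q : nat) (V Q : {group gT}) :
    prime p -> prime q -> p != q -> p.-abelem V -> q.-group Q -> Q \subset 'N(V) ->
    Q^`(1) \subset 'C(V) ->
    {in Q, forall x, x ^+ p.-1 \in 'C(V) /\ x ^+ q \in 'C(V)} ->
  submodular Q (V <*> Q)%G.
Proof.
move=> p_pr q_pr neq_pq; have [n] := ubnP #|V|.
elim: n gT V Q => // n IHn gT V Q /ltnSE-leVn abelV qQ nVQ cQ'V expQ.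
have [-> | ntV] := eqVneq V 1%G.
  rewrite (_ : (1 <*> Q)%G = Q); first exact: submodular_refl.
  by apply: val_inj; rewrite /= joing1G.
have [W minW sWV] := minnormal_exists ntV nVQ.
have [/andP[ntW nWQ] _] := mingroupP minW.
have abV := abelem_abelian abelV; have sCVW : 'C(V) \subset 'C(W) := centS sWV.
have nsWV : W <| V by rewrite -sub_abelian_normal.
have nWV := normal_norm nsWV.
have nsWL : W <| V <*> Q.
  by rewrite /normal (subset_trans sWV) ?joing_subl // join_subG nWV.
have oW : #|W| = p.
  apply: minnormal_abelem_order minW _ _ => //; first exact: abelemS abelV.
    exact: subset_trans sCVW.
  by move=> x /expQ[? _]; apply: (subsetP sCVW).
have sWL : (W <*> Q)%G \subset (V <*> Q)%G by rewrite genS ?setSU.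
apply: (@submodular_trans _ _ (W <*> Q)%G).
  apply/modular_submodular/(submodular_normal_prime p_pr q_pr) => //.
  by move=> x /expQ[_ ?]; apply: (subsetP sCVW).
apply: (submodular_cosetpre nsWL) => //; first exact: joing_subl.
have cQVb x : x \in Q -> x \in 'C(V) -> coset W x \in 'C(V / W).
  move=> Qx Cx; have := quotient_cent W V; move/subsetP; apply.
  by rewrite mem_quotient.
suffices : submodular (Q / W)%G ((V / W)%G <*> (Q / W)%G)%G.
  congr submodular; apply: val_inj; rewrite /= quotientY ?normG //.
  by rewrite trivg_quotient joing1G.
apply: IHn.
- by apply: leq_trans leVn; apply: ltn_quotient.
- exact: quotient_abelem.
- exact: quotient_pgroup.
- exact: quotient_norms.
- rewrite -quotient_der //; apply: subset_trans (quotient_cent W V).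
  exact: quotientS.
move=> _ /morphimP[x Nx Qx ->]; have [x1 x2] := expQ x Qx.
by split; [have := cQVb _ (groupX p.-1 Qx) x1 | have := cQVb _ (groupX q Qx) x2];
  rewrite morphX.
Qed.

Lemma sylow_screen_chief_submodular (gT : finGroupType) (p q : nat)
    (G V Q : {group gT}) :
    prime p -> prime q -> minnormal V G -> V \subset G -> p.-abelem V ->
    sylow_screen p (G / 'C_G(V))%G -> q.-Sylow(G) Q ->
  submodular Q (V <*> Q)%G.
Proof.
move=> p_pr q_pr minV sVG abelV [_ scrV] sylQ; have [sQG qQ _] := and3P sylQ.
have [/andP[ntV nVG] _] := mingroupP minV.
have nsVG : V <| G by apply/andP.
(* For [q = p] the normal p-subgroup [V] already lies in [Q]. *)
have [epq | neq_pq] := eqVneq p q.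
  suffices -> : (V <*> Q)%G = Q by exact: submodular_refl.
  apply: val_inj; apply/joing_idPr; rewrite -epq in sylQ.
  apply: subset_trans (pcore_sub_Hall sylQ).
  exact: pcore_max (abelem_pgroup abelV) nsVG.
have nVQ := subset_trans sQG nVG.
have nsCG : 'C_G(V) <| G by rewrite /normal subsetIl normsI ?normG ?norms_cent.
have nCQ := subset_trans sQG (normal_norm nsCG).
have sylQC := quotient_pHall nCQ sylQ.
have [abQC expQC] :=
  (prime_pgroup_exponentP p q_pr (pHall_pgroup sylQC)).1 (scrV q (Q / _)%G q_pr sylQC).
have sCC : 'C_G(V) \subset 'C(V) := subsetIr G 'C(V).
apply: submodular_of_pgroup_act neq_pq abelV qQ nVQ _ _ => //.
  by apply: subset_trans sCC; apply: der1_min.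
move: expQC; rewrite dvdn_gcd => /andP[/exponentP expq /exponentP expp].
move=> x Qx; have Nx := subsetP nCQ x Qx; have QCx := mem_quotient 'C_G(V) Qx.
split; apply: (subsetP sCC); apply: coset_idr; rewrite ?groupX // morphX //.
  exact: expp.
exact: expq.
Qed.

(** If ['Z(V) = 1], then [V] embeds in [G / 'C_G(V)]; otherwise ['Z(V) = V] by minimality. *)
Lemma minnormal_solvable_quotient_cent (gT : finGroupType) (G V : {group gT}) :
  minnormal V G -> V \subset G -> solvable (G / 'C_G(V)) -> solvable V.
Proof.
move=> minV sVG solGC; have [/andP[ntV nVG] minVP] := mingroupP minV.
have [Z1 | ntZ] := eqsVneq 'Z(V) 1.
  have nCV : V \subset 'N('C_G(V)).
    by rewrite normsI ?norms_cent ?normsG.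
  rewrite (isog_sol (quotient_isog nCV _)); first exact: solvableS (quotientS _ sVG) solGC.
  by rewrite -setIA [_ :&: V]setIC; apply/trivgP; rewrite -Z1 subsetIr.
apply/abelian_sol/center_idP/(minVP 'Z(V)%G); last exact: center_sub.
by rewrite ntZ /= gFnorm_trans.
Qed.

(** Lets a chief factor be treated as a minimal normal subgroup of [G / K]. *)
Lemma quotient_cent_isog (gT : finGroupType) (G K : {group gT})
    (V : {group coset_of K}) :
    K <| G -> G / K \subset 'N(V) ->
  G / 'C_G(V | 'Q) \isog (G / K) / 'C_(G / K)(V).
Proof.
move=> nsKG nVG.
have eC : 'C_G(V | 'Q) = coset K @*^-1 'C_(G / K)(V).
  by rewrite astabQ morphpreI quotientGK.
have nsC : 'C_G(V | 'Q) <| G.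
  rewrite eC -[X in _ <| X](quotientGK nsKG) cosetpre_normal.
  by rewrite /normal subsetIl normsI ?normG ?norms_cent.
have sKC : K \subset 'C_G(V | 'Q) by rewrite eC sub_cosetpre.
rewrite isog_sym; have := third_isog sKC nsKG nsC.
by have -> : 'C_G(V | 'Q) / K = 'C_(G / K)(V) by rewrite eC cosetpreK.
Qed.

Lemma sylow_screen_morphim (p : nat) (aT rT : finGroupType) (D G : {group aT})
    (f : {morphism D >-> rT}) :
  G \subset D -> sylow_screen p G -> sylow_screen p (f @* G)%G.
Proof.
move=> sGD [solG scrG]; split=> [|q Q q_pr sylQ]; first exact: morphim_sol.
have [P sylP eQ] := morphim_Sylow_lift sGD sylQ.
have [abP expP] :=
  (prime_pgroup_exponentP p q_pr (pHall_pgroup sylP)).1 (scrG q P q_pr sylP).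
apply/(prime_pgroup_exponentP p q_pr (pHall_pgroup sylQ)).
by rewrite eQ morphim_abelian // (dvdn_trans (exponent_morphim _ _)).
Qed.

Lemma sylow_screen_isog (p : nat) (gT rT : finGroupType)
    (G : {group gT}) (H : {group rT}) :
  G \isog H -> sylow_screen p G -> sylow_screen p H.
Proof.
case/isogP=> f _ eH /(sylow_screen_morphim f (subxx _)).
by congr (sylow_screen p); apply: val_inj.
Qed.

(** * Formations *)

Lemma formation_sylow_screen (p : nat) : formation (sylow_screen p).
Proof.
split=> [gT rT G H | gT G N /andP[_ nNG] | gT H A B nsAH nsBH scrA scrB].
- exact: sylow_screen_isog.
- exact: sylow_screen_morphim.
have [[sAH nAH] [sBH nBH]] := (andP nsAH, andP nsBH).
have nsDH : A :&: B <| H by apply: normalI.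
have nDH := normal_norm nsDH.
split=> [|q Q q_pr sylQ].
  (* Solubility is an extension argument: [A / (A :&: B)] embeds in [H / B], with quotient
     [H / A]. *)
  have nsAD : A / (A :&: B) <| H / (A :&: B) by apply: quotient_normal.
  rewrite /= (series_sol nsAD); apply/andP; split.
    rewrite setIC (isog_sol (second_isog (subset_trans sAH nBH))).
    by apply: solvableS (quotientS B sAH) _; case: scrB.
  rewrite (isog_sol (third_isog (subsetIl A B) nsDH nsAH)).
  by case: scrA.
have [P sylP eQ] := morphim_Sylow_lift nDH sylQ.
rewrite -quotientE in eQ.
have [sPH qP _] := and3P sylP; have nDP := subset_trans sPH nDH.
have [nAP nBP] := (subset_trans sPH nAH, subset_trans sPH nBH).
have sylPA := quotient_pHall nAP sylP; have sylPB := quotient_pHall nBP sylP.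
have [abA expA] :=
  (prime_pgroup_exponentP p q_pr (pHall_pgroup sylPA)).1 (scrA.2 q (P / A)%G q_pr sylPA).
have [abB expB] :=
  (prime_pgroup_exponentP p q_pr (pHall_pgroup sylPB)).1 (scrB.2 q (P / B)%G q_pr sylPB).
apply/(prime_pgroup_exponentP p q_pr (pHall_pgroup sylQ)); rewrite eQ; split.
  by apply: sub_der1_abelian; rewrite subsetI !der1_min.
apply/exponentP=> _ /morphimP[x Nx Px ->]; rewrite -morphX //; apply: coset_id.
rewrite inE; apply/andP; split; apply: coset_idr.
- by rewrite groupX // (subsetP nAP).
- rewrite morphX ?(subsetP nAP) //.
  by move/exponentP: expA; apply; apply: mem_quotient.
- by rewrite groupX // (subsetP nBP).
rewrite morphX ?(subsetP nBP) //.
by move/exponentP: expB; apply; apply: mem_quotient.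
Qed.

(** For closure under intersections, [A <*> P] and [B <*> P] are submodular as preimages of Sylow
    subgroups, and hence so is their intersection [T], whose image is [Q]. *)
Lemma formation_sylow_submodular : formation sylow_submodular.
Proof.
split=> [gT rT G H | gT G N /andP[_ nNG] | gT H A B nsAH nsBH FA FB].
- case/isogP=> f _ eH /(sylow_submodular_morphim (f := f) (subxx _)).
  by have -> : (f @* G)%G = H by apply: val_inj.
- exact: sylow_submodular_quotient.
have [[sAH nAH] [sBH nBH]] := (andP nsAH, andP nsBH).
have nsDH : A :&: B <| H by apply: normalI.
have nDH := normal_norm nsDH.
move=> q Q q_pr sylQ.
have [P sylP eQ] := morphim_Sylow_lift nDH sylQ.
have [sPH qP _] := and3P sylP.
have subP (N : {group gT}) : N <| H -> sylow_submodular (H / N)%G ->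
    submodular (N <*> P)%G H /\ q.-group ((N <*> P) / N).
  move=> nsNH FN; have [sNH nNH] := andP nsNH.
  have nNP := subset_trans sPH nNH.
  have eNP : (N <*> P) / N = P / N.
    by rewrite quotientY ?normG // trivg_quotient joing1G.
  split; last by rewrite eNP quotient_pgroup.
  apply: (submodular_cosetpre nsNH); rewrite ?joing_subl // ?join_subG ?sNH //.
  have := FN q (P / N)%G q_pr (quotient_pHall nNP sylP).
  by congr submodular; apply: val_inj; rewrite /= eNP.
have [subA qA] := subP A nsAH FA; have [subB qB] := subP B nsBH FB.
(* T / (T :&: A) and T / (T :&: B) are q-groups, so T and P have the same image
   modulo A :&: B. *)
pose T := (A <*> P :&: B <*> P)%G.
have subT : submodular T H by apply: submodular_intersect.
have sTH := submodular_sub subT.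
have sPT : P \subset T by rewrite subsetI !joing_subr.
have sDT : A :&: B \subset T by rewrite setISS ?joing_subl.
have qTD : q.-group (T / (A :&: B)).
  have nDT := subset_trans sTH nDH.
  rewrite /pgroup card_quotient //.
  have sTAT : T :&: A \subset T := subsetIl T A.
  have sDTA : A :&: B \subset T :&: A by rewrite subsetI sDT subsetIl.
  rewrite -(Lagrange_index sTAT sDTA) pnatM; apply/andP; split.
    rewrite indexgI -card_quotient ?(subset_trans sTH) //.
    by apply: pgroupS qA; apply: quotientS; apply: subsetIl.
  (* The remaining index is the order of the image of [T :&: A] modulo [B], inside
     [(B <*> P) / B]. *)
  have -> : (A :&: B)%G = (T :&: A :&: B)%G.
    by apply: val_inj; rewrite /= -setIA (setIidPr sDT).
  rewrite indexgI -card_quotient; last by rewrite subIset ?(subset_trans sTH).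
  by apply: pgroupS qB; apply: quotientS; rewrite subIset // subsetIr.
have <- : (T / (A :&: B))%G = Q.
  apply: val_inj; apply: sub_pHall sylQ qTD _ _; last exact: quotientS.
  by rewrite eQ; apply: quotientS.
exact: submodular_morphim nDH subT.
Qed.

(** * The two inclusions between the class and its local description *)

Lemma sylow_submodular_LF (gT : finGroupType) (G : {group gT}) :
  sylow_submodular G -> LF sylow_screen G.
Proof.
move=> FG H K p chiefHK p_pr pHK.
have [/maxgroupp/andP[/andP[sKH _] nKG] nsHG] := andP chiefHK.
have minHK := chief_factor_minnormal chiefHK.
have [sHG nHG] := andP nsHG.
have nsKG : K <| G by rewrite /normal nKG (subset_trans sKH).
have FGK := sylow_submodular_quotient nKG FG.
have scr := chief_sylow_screen FGK minHK (quotientS K sHG) p_pr pHK.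
apply: sylow_screen_isog scr; rewrite isog_sym.
exact: quotient_cent_isog (quotient_norms K nHG).
Qed.

(** Along a chief series, [K <*> Q] is submodular in [H <*> Q] for each factor [H / K]; composing
    these links leads from [Q] to [G]. *)
Lemma LF_sylow_submodular (gT : finGroupType) (G : {group gT}) :
  LF sylow_screen G -> sylow_submodular G.
Proof.
move=> LFG q Q q_pr sylQ; have [sQG qQ _] := and3P sylQ.
suffices chain s (K : {group gT}) :
    (G.-chief).-series K s -> last K s = G -> K <| G -> submodular (K <*> Q)%G G.
  have [s chs lasts] := chief_series_exists (normal_refl G).
  have := chain s 1%G chs lasts (normal1 G).
  by congr submodular; apply: val_inj; rewrite /= joing1G.
elim: s K => [|H s IHs] K /=.
  move=> _ -> _; have -> : (G <*> Q)%G = G; last exact: submodular_refl.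
  by apply: val_inj; apply/joing_idPl.
case/andP=> chiefHK chs lasts nsKG.
have [/maxgroupp/andP[/andP[sKH _] nKG] nsHG] := andP chiefHK.
have minHK := chief_factor_minnormal chiefHK.
have [sHG nHG] := andP nsHG.
apply: submodular_trans (IHs H chs lasts nsHG).
have sHQG : H <*> Q \subset G by rewrite join_subG sHG.
have sKQHQ : K <*> Q \subset H <*> Q by rewrite genS ?setSU.
have nsKHQ : K <| H <*> Q.
  by apply: normalS nsKG; rewrite ?(subset_trans sKH) ?joing_subl.
have nKQ := subset_trans sQG nKG; have nKH := subset_trans sHG nKG.
have sHKG : H / K \subset G / K := quotientS K sHG.
have scrHK p : prime p -> p %| #|H / K| ->
    sylow_screen p (G / K / 'C_(G / K)(H / K))%G.
  move=> p_pr pHK; apply: sylow_screen_isog (LFG H K p chiefHK p_pr pHK).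
  exact: quotient_cent_isog (quotient_norms K nHG).
have [/andP[ntHK _] _] := mingroupP minHK.
pose p := pdiv #|H / K|; have HK_gt1 : 1 < #|H / K| by rewrite cardG_gt1.
have p_pr : prime p by apply: pdiv_prime.
have pHK : p %| #|H / K| by apply: pdiv_dvd.
have scr := scrHK p p_pr pHK.
(* Membership in [LF] gives solubility only of the group induced on [H / K]; that of the factor
   itself follows by minimality. *)
have solHK : solvable (H / K).
  by apply: minnormal_solvable_quotient_cent minHK sHKG _; case: scr.
have abelHK := minnormal_abelem_prime minHK sHKG solHK p_pr pHK.
have := sylow_screen_chief_submodular p_pr q_pr minHK sHKG abelHK scr
  (quotient_pHall nKQ sylQ).
move=> sub; apply: (submodular_cosetpre nsKHQ) => //; first exact: joing_subl.
move: sub; congr submodular; apply: val_inj; rewrite /= quotientY ?normG //.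
by rewrite trivg_quotient joing1G.
Qed.

Theorem theorem3p6 :
  local_formation sylow_submodular /\
  local_screen_of sylow_screen sylow_submodular.
Proof.
have screenF : local_screen_of sylow_screen sylow_submodular.
  split=> [p _ | gT G]; first exact: formation_sylow_screen.
  by split; [apply: sylow_submodular_LF | apply: LF_sylow_submodular].
by split; [split; [apply: formation_sylow_submodular | exists sylow_screen] |].
Qed.
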